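(* Let $B\ge 1$, $\Omega=\{\omega_1,\omega_2\}$, $\mathcal F=2^\Omega$, $X(\omega_1)=B$, $X(\omega_2)=0$. Let $\phi$ be a divergence function such that $[1-\delta,1+\delta]\subseteq \mathrm{int}(\mathrm{dom}(\phi))$ for some $\delta>0$ and $\lim_{x\to\infty}\phi(x)/x=\infty$, and let $\tau>0$. Then there exists $\overline p_{\phi,\tau}>0$, depending only on $\phi$ and $\tau$, such that for any $\epsilon\in(0,B/4)$, any positive integer $n\le \frac{\overline p_{\phi,\tau}B^2}{8\epsilon^2}$, and any estimator $\hat{\mathcal R}_n(X):\Omega^n\to\mathbb R$ that is $\mathcal F^{\otimes n}$-measurable (a function of $n$ i.i.d. samples), there exists a probability measure $P$ on $(\Omega,\mathcal F)$ for which $$P^{\otimes n}\Big(\big|\hat{\mathcal R}_n(X)-\mathcal R^P(X)\big|\ge\tfrac{\epsilon}{8}\Big)\ge\tfrac14 .$$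
   Context: A divergence function is a convex lower semicontinuous $\phi:\mathbb R\to[0,\infty]$ with $\phi(1)=0$ and $\phi(x)=+\infty$ for $x<0$. For a probability measure $P$ on a measurable space $(\Omega,\mathcal F)$, a radius $\tau$ and a bounded measurable $X:\Omega\to\mathbb R$, the distributionally robust functional is $$\mathcal R(X)=\mathcal R^P(X)=\sup\Big\{\int_\Omega X\zeta\,dP:\ \zeta\ge 0 \text{ measurable},\ \int_\Omega\zeta\,dP=1,\ \int_\Omega\phi(\zeta)\,dP\le\tau\Big\}.$$ *)

(* Defs.v *)
From HB Require Import structures.
From mathcomp Require Import all_boot all_order all_algebra.
From mathcomp Require Import all_classical all_reals all_analysis.
Set Implicit Arguments.
Unset Strict Implicit.
Unset Printing Implicit Defensive.
Import Order.TTheory GRing.Theory Num.Theory.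
Import numFieldNormedType.Exports.

Local Open Scope classical_set_scope.
Local Open Scope ring_scope.
Local Open Scope ereal_scope.

(* Convexity of an extended-real-valued function: at the endpoints t = 0 and
   t = 1 the convention 0 * +oo = 0 makes the inequality trivial. *)
Definition ereal_convex (R : realType) (phi : R -> \bar R) : Prop :=
  forall x y t : R, (0 <= t <= 1)%R ->
    phi (t * x + (1 - t) * y)%R <= t%:E * phi x + (1 - t)%:E * phi y.

Record divergence_function (R : realType) (phi : R -> \bar R) : Prop := {
  divergence_ge0 : forall x : R, 0 <= phi x ;
  divergence_convex : ereal_convex phi ;
  divergence_lsc : lower_semicontinuous phi ;
  divergence1 : phi 1%R = 0 ;
  divergence_neg : forall x : R, (x < 0)%R -> phi x = +oo }.

Definition edom (R : realType) (phi : R -> \bar R) : set R :=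
  [set x | phi x < +oo].

Section robust.
Context (d : measure_display) (T : measurableType d) (R : realType).
Variables (phi : R -> \bar R) (tau : R) (P : probability T R).

Definition feasible_density : set (T -> R) :=
  [set zeta : T -> R | [/\ measurable_fun setT zeta,
                  forall w, (0 <= zeta w)%R,
                  \int[P]_w (zeta w)%:E = 1 &
                  \int[P]_w phi (zeta w) <= tau%:E]].

Definition robust (X : T -> R) : \bar R :=
  ereal_sup [set \int[P]_w (X w * zeta w)%:E | zeta in feasible_density].

End robust.

Section product_probability.
Context (d : measure_display) (T : measurableType d) (R : realType).

Definition tuple_cons (n : nat) (x : T * n.-tuple T) : n.+1.-tuple T :=
  [the n.+1.-tuple T of x.1 :: x.2].

Lemma measurable_tuple_cons (n : nat) :
  measurable_fun setT (@tuple_cons n).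
Proof. by apply: measurable_cons. Qed.

HB.instance Definition _ (n : nat) :=
  isMeasurableFun.Build _ _ _ _ (@tuple_cons n) (@measurable_tuple_cons n).

Variable P : probability T R.

(* P^{⊗n} on T^n, as the image of P ⊗ P^{⊗(n-1)} under (x, t) |-> x :: t. *)
Fixpoint power_prob (n : nat) : probability (n.-tuple T) R :=
  match n with
  | 0%N => @dirac _ _ [tuple] R
  | m.+1 => distribution (P \x power_prob m) (@tuple_cons m)
  end.

(* The product rule on measurable rectangles, which characterizes P^{⊗n}. *)
Lemma power_probE (n : nat) (A : 'I_n -> set T) :
  (forall i, measurable (A i)) ->
  power_prob n [set t : n.-tuple T | forall i, A i (tnth t i)] = \prod_(i < n) P (A i).
Proof.
elim: n A => [|n IH] A mA.
  rewrite big_ord0 /= diracE mem_set//= => -[].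
  by case.
rewrite big_ord_recl /= /distribution /pushforward.
rewrite -(IH (fun i => A (lift ord0 i)))//.
rewrite -product_measure1E//; last first.
  rewrite (_ : [set _ | _] = \bigcap_(i in [set: 'I_n])
     ((fun t : n.-tuple T => tnth t i) @^-1` A (lift ord0 i))).
    apply: fin_bigcap_measurable => // i _; rewrite -[X in measurable X]setTI.
    exact: measurable_tnth.
  by apply/seteqP; split => t /= tA i; [move=> _|]; exact: tA.
congr (_ _); apply/seteqP; split => -[x t] /=.
  by move=> tA; split => [|i]; [exact: (tA ord0)|have := tA (lift ord0 i); rewrite tnthS].
move=> [xA tA] i; have [j ->|->] := unliftP ord0 i; last exact: xA.
by rewrite tnthS; exact: tA.
Qed.

End product_probability.

(* Ω = {ω1, ω2} is bool, with ω1 = true, ω2 = false; its library σ-algebra is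
   the power set. *)
Definition two_point_payoff (R : realType) (B : R) (w : bool) : R :=
  if w then B else 0%R.

(* Main.v *)
(* Le Cam's two-point method with Bernoulli measures of parameters p and
   p' = p + eps / (2 B). Superlinearity of phi gives a fixed small p with
   robust value at most B / 2. Since p |-> robust value lies above its chord to
   the point (1, B), moving from p to p' raises the robust value by at least
   eps / 4, while the chi-squared divergence eps^2 / (4 B^2 p (1 - p)) between
   the two measures is at most of order 1 / n, so the n-fold products cannot be
   told apart. *)
Require Import Defs.
From mathcomp Require Import all_boot all_order all_algebra.
From mathcomp Require Import all_classical all_reals all_analysis.
From mathcomp Require Import measurable_realfun ring lra.
Set Implicit Arguments.
Unset Strict Implicit.
Unset Printing Implicit Defensive.
Import Order.TTheory GRing.Theory Num.Theory.
Import numFieldNormedType.Exports.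

Local Open Scope classical_set_scope.
Local Open Scope ring_scope.

(** * Robust values of the two-point payoff under Bernoulli measures *)

Section two_point_robust.
Context (R : realType) (phi : R -> \bar R).
Hypothesis phi_div : divergence_function phi.

Lemma feasible_bernoulliP (tau p : R) (zeta : bool -> R) : 0 <= p <= 1 ->
  feasible_density phi tau (bernoulli_prob p) zeta <->
  [/\ forall w, 0 <= zeta w, p * zeta true + (1 - p) * zeta false = 1 &
      (p%:E * phi (zeta true) + (1 - p)%:E * phi (zeta false) <= tau%:E)%E].
Proof.
move=> p01; split.
  case=> _ zeta0 + phitau; rewrite integral_bernoulli_prob// /unstable.onem.
  move: phitau; rewrite integral_bernoulli_prob//; last first.
    by move=> w; exact: divergence_ge0.
  by move=> ? [?]; split.
case=> zeta0 zeta1 zetatau; split => //.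
  by rewrite integral_bernoulli_prob// -!EFinM -EFinD zeta1.
by rewrite integral_bernoulli_prob// => w; exact: divergence_ge0.
Qed.

Lemma integral_two_point_payoff (B p : R) (zeta : bool -> R) :
  0 <= B -> 0 <= p <= 1 -> (forall w, 0 <= zeta w) ->
  (\int[bernoulli_prob p]_w (two_point_payoff B w * zeta w)%:E =
   (B * (p * zeta true))%:E)%E.
Proof.
move=> B0 p01 zeta0; rewrite integral_bernoulli_prob//; last first.
  by case; rewrite lee_fin mulr_ge0.
by rewrite /two_point_payoff mul0r mule0 adde0 -EFinM; congr EFin; ring.
Qed.

Lemma robust_two_point_le (tau B p q : R) : 0 <= B -> 0 <= p <= 1 ->
  (forall zeta, feasible_density phi tau (bernoulli_prob p) zeta ->
     p * zeta true <= q) ->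
  (robust phi tau (bernoulli_prob p) (two_point_payoff B) <= (B * q)%:E)%E.
Proof.
move=> B0 p01 hq; apply: ge_ereal_sup => _ [zeta fzeta <-].
have [zeta0 _ _] := (feasible_bernoulliP tau zeta p01).1 fzeta.
by rewrite integral_two_point_payoff// lee_fin ler_wpM2l// hq.
Qed.

(** The constant density 1 is feasible since [phi 1 = 0], which bounds the supremum below; the mass
    constraint forces [p * zeta true <= 1], which bounds it above by [B]. *)
Lemma robust_two_point_fin_num (tau B p : R) : 0 <= B -> 0 <= p <= 1 -> 0 <= tau ->
  robust phi tau (bernoulli_prob p) (two_point_payoff B) \is a fin_num.
Proof.
move=> B0 p01 tau0.
have f1 : feasible_density phi tau (bernoulli_prob p) (cst 1 : bool -> R).
  apply/feasible_bernoulliP => //; split => //=; first by ring.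
  by rewrite (divergence1 phi_div) !mule0 adde0.
have := @robust_two_point_le tau B p 1 B0 p01.
rewrite mulr1 => robust_le.
rewrite fin_numElt; apply/andP; split.
  apply: (@lt_le_trans _ _ (B * (p * 1))%:E); first exact: ltNyr.
  apply: ereal_sup_ubound; exists (cst 1) => //.
  by rewrite integral_two_point_payoff.
apply: le_lt_trans (ltry B); apply: robust_le => zeta fzeta.
have [zeta0 zeta1 _] := (feasible_bernoulliP tau zeta p01).1 fzeta.
rewrite -zeta1 lerDl mulr_ge0//; lra.
Qed.

(* If [zeta] is feasible for [p], then so is for [p'] the density keeping
   [zeta false] and moving [zeta true] towards [1] to restore the mass. *)
Lemma robust_two_point_chord (tau B p p' : R) : 0 <= B -> 0 <= tau ->
  0 < p -> p <= p' -> p' < 1 ->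
  let lam := (1 - p') / (1 - p) in
  (lam%:E * robust phi tau (bernoulli_prob p) (two_point_payoff B)
     + ((1 - lam) * B)%:E
   <= robust phi tau (bernoulli_prob p') (two_point_payoff B))%E.
Proof.
move=> B0 tau0 p0 pp' p'1 /=; set lam := (_ / _).
have p01 : 0 <= p <= 1 by lra.
have p'01 : 0 <= p' <= 1 by lra.
have lam0 : 0 < lam by rewrite divr_gt0//; lra.
have lam1 : lam <= 1 by rewrite ler_pdivrMr; lra.
have lamE : lam * (1 - p) = 1 - p' by rewrite divfK//; apply/eqP; lra.
have p'0 : p' != 0 by apply/eqP; lra.
clearbody lam.
have Rfin := robust_two_point_fin_num B0 p01 tau0.
rewrite -leeBrDr// -lee_pdivlMl//.
rewrite /robust; apply: ge_ereal_sup => _ [zeta fzeta <-].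
have [zeta0 zeta1 zetatau] := (feasible_bernoulliP tau zeta p01).1 fzeta.
rewrite integral_two_point_payoff//.
rewrite lee_pdivlMl// leeBrDr//.
(* Mass balance dictates [p' * s = lam * p]: then [p' * (1 - s) = 1 - lam], and the new density has
   mass [lam * 1 + (1 - lam) = 1]. *)
pose s := lam * p / p'.
have s0 : 0 <= s by rewrite /s divr_ge0 ?mulr_ge0 ?ltW//; lra.
have s1E : p' * (1 - s) = 1 - lam.
  by rewrite /s mulrBr mulrCA divff// !mulr1; lra.
have sE : p' * s = lam * p by rewrite /s mulrCA divff// mulr1.
have s1 : s <= 1.
  by rewrite -subr_ge0 -(@pmulr_rge0 _ p'); [rewrite s1E; lra|lra].
clearbody s.
pose zeta' b := if b then s * zeta true + (1 - s) * 1 else zeta false.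
have zeta'0 w : 0 <= zeta' w.
  by case: w => //=; rewrite mulr1 addr_ge0 ?mulr_ge0 ?subr_ge0.
have fzeta' : feasible_density phi tau (bernoulli_prob p') zeta'.
  apply/feasible_bernoulliP => //; split => //=.
    by rewrite mulrDr !mulrA sE s1E -lamE; nra.
  have phi0 x := divergence_ge0 phi_div x.
  apply: (@le_trans _ _
      (lam%:E * (p%:E * phi (zeta true) + (1 - p)%:E * phi (zeta false)))%E).
    have [p0' p1'] : 0 <= p /\ 0 <= 1 - p by lra.
    rewrite ge0_muleDr ?mule_ge0 ?lee_fin//.
    rewrite !muleA -!EFinM lamE leeD2r//.
    rewrite -sE EFinM -muleA lee_wpmul2l ?lee_fin//; first lra.
    (* Since [phi] vanishes at 1, moving towards 1 multiplies its value by at most [s]; the whole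
       divergence is then at most [lam * tau]. *)
    apply: le_trans (divergence_convex phi_div _ _ _) _; first lra.
    by rewrite (divergence1 phi_div) mule0 adde0.
  apply: (@le_trans _ _ (lam%:E * tau%:E)%E).
    by rewrite lee_wpmul2l// lee_fin ltW.
  by rewrite -EFinM lee_fin; nra.
apply: (@le_trans _ _ (B * (p' * zeta' true))%:E).
  rewrite -EFinM -EFinD lee_fin /zeta' mulr1 mulrDr (mulrA p') sE s1E; lra.
by apply: ereal_sup_ubound; exists zeta' => //; rewrite integral_two_point_payoff.
Qed.

(* If [p * zeta true > q] then [zeta true] is so large that
   [p * phi (zeta true) >= p * (tau / q) * zeta true > tau]. *)
Lemma two_point_density_le (tau q : R) : 0 < tau -> 0 < q ->
  (phi x * (x^-1)%:E)%E @[x --> +oo] --> +oo%E ->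
  exists2 p0 : R, 0 < p0 & forall p, 0 < p -> p <= p0 -> p <= 1 -> forall zeta,
    feasible_density phi tau (bernoulli_prob p) zeta -> p * zeta true <= q.
Proof.
move=> tau0 q0 /cvgeyPge/(_ (tau / q)) [K [_ hK]].
(* Below this threshold p (|K| + 1) <= q, so [p * zeta true > q] forces [zeta true > K], where the
   superlinear bound applies. *)
exists (q / (`|K| + 1)); first by rewrite divr_gt0// ltr_wpDl.
move=> p p0 ple p1 zeta.
have p01 : 0 <= p <= 1 by lra.
move=> /(feasible_bernoulliP tau zeta p01) [zeta0 zeta1 zetatau].
rewrite leNgt; apply/negP => qlt.
have zt0 : 0 < zeta true by rewrite -(@pmulr_rgt0 _ p)//; lra.
have Kz : K < zeta true.
  apply: le_lt_trans (ler_norm K) _.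
  have : p * (`|K| + 1) < p * zeta true.
    by apply: le_lt_trans qlt; rewrite -ler_pdivlMr// ltr_wpDl.
  by rewrite ltr_pM2l//; lra.
have /= := hK _ Kz; rewrite lee_pdivlMr// => phile.
have : (p%:E * ((tau / q)%:E * (zeta true)%:E) <= tau%:E)%E.
  apply: le_trans zetatau.
  apply: (@le_trans _ _ (p%:E * phi (zeta true))%E).
    by rewrite lee_wpmul2l// lee_fin ltW.
  by rewrite leeDl// mule_ge0 ?lee_fin ?(divergence_ge0 phi_div)//; lra.
rewrite -!EFinM lee_fin mulrCA leNgt => /negP; apply.
by rewrite mulrAC ltr_pdivlMr// ltr_pM2l.
Qed.

End two_point_robust.

(** * Distinguishing products of Bernoulli measures *)

Section power_bernoulli.
Context (R : realType).

Lemma power_bernoulliS (p : R) (n : nat) (A : set (n.+1.-tuple bool)) :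
  0 <= p <= 1 ->
  (power_prob (bernoulli_prob p) n.+1 A =
   p%:E * power_prob (bernoulli_prob p) n [set t | A (tuple_cons (true, t))] +
   (1 - p)%:E *
     power_prob (bernoulli_prob p) n [set t | A (tuple_cons (false, t))])%E.
Proof.
(* By definition, the product measure integrates the measures of the sections over the first
   sample. *)
move=> p01; rewrite [LHS]integral_bernoulli_prob//.
have xsecE b : [set t | A (tuple_cons (b, t))] =
    xsection (@tuple_cons _ _ n @^-1` A) b.
  by apply/seteqP; split => t; rewrite /xsection/= inE.
by rewrite !xsecE.
Qed.

Lemma power_bernoulli_fin_num (p : R) (n : nat) (A : set (n.-tuple bool)) :
  0 <= p <= 1 -> power_prob (bernoulli_prob p) n A \is a fin_num.
Proof.
move=> p01; elim: n A => [|n IH] A; first by rewrite /= diracE.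
by rewrite power_bernoulliS// fin_numD !fin_numM.
Qed.

(** The chi-squared divergence (p' - p)^2 / p + (p' - p)^2 / (1 - p), over a common denominator. *)
Definition chi2_bernoulli (p p' : R) := (p' - p) ^+ 2 / (p * (1 - p)).

(** Cauchy-Schwarz under parameter [p] for the likelihood ratio, whose second moment is 1 +
    chi-squared; the defect is an explicit square. *)
Lemma bernoulli_cauchy_schwarz (p p' u v : R) : 0 < p -> p < 1 ->
  (p' * u + (1 - p') * v) ^+ 2 <=
  (1 + chi2_bernoulli p p') * (p * u ^+ 2 + (1 - p) * v ^+ 2).
Proof.
move=> p0 p1; have pp : 0 < p * (1 - p) by rewrite mulr_gt0//; lra.
rewrite -subr_ge0.
rewrite (_ : _ - _ = (p' * (1 - p) * v - p * (1 - p') * u) ^+ 2 / (p * (1 - p))).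
  by rewrite divr_ge0 ?sqr_ge0 ?ltW.
rewrite /chi2_bernoulli; field.
by apply/andP; split; apply/eqP; lra.
Qed.

(** Induction by conditioning on the first sample: each coordinate costs one Cauchy-Schwarz factor.
    With no samples left, the probability is 0 or 1 and equals its square. *)
Lemma power_bernoulli_sqr_le (p p' : R) (n : nat) (A : set (n.-tuple bool)) :
  0 < p -> p < 1 -> 0 <= p' <= 1 ->
  fine (power_prob (bernoulli_prob p') n A) ^+ 2 <=
  (1 + chi2_bernoulli p p') ^+ n * fine (power_prob (bernoulli_prob p) n A).
Proof.
move=> p0 p1 p'01; have p01 : 0 <= p <= 1 by lra.
elim: n A => [|n IH] A.
  have prob0 (q : R) : power_prob (bernoulli_prob q) 0 A = ([tuple] \in A)%:R%:E.
    exact: diracE.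
  rewrite !prob0 expr0 mul1r.
  by case: (_ \in _) => /=; rewrite ?expr1n ?expr0n.
have fineS (q : R) (q01 : 0 <= q <= 1) :
    fine (power_prob (bernoulli_prob q) n.+1 A) =
    q * fine (power_prob (bernoulli_prob q) n [set t | A (tuple_cons (true, t))]) +
    (1 - q) *
      fine (power_prob (bernoulli_prob q) n [set t | A (tuple_cons (false, t))]).
  by rewrite power_bernoulliS// fineD ?fineM ?fin_numM ?power_bernoulli_fin_num.
rewrite !fineS//; apply: le_trans (bernoulli_cauchy_schwarz _ _ _ p0 p1) _.
have chi0 : 0 <= 1 + chi2_bernoulli p p'.
  by rewrite addr_ge0// divr_ge0 ?sqr_ge0// mulr_ge0//; lra.
rewrite [(1 + _) ^+ _.+1]exprS -mulrA ler_wpM2l// mulrDr.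
by apply: lerD; rewrite [leRHS]mulrCA ler_wpM2l ?IH//; lra.
Qed.

Lemma bernoulli_expr_le (x : R) (n : nat) : 0 <= x -> n%:R * x <= 2^-1 ->
  (1 + x) ^+ n <= 2.
Proof.
move=> x0 nx.
(* Inductive, as (1 + x)(1 - (n + 1)x) <= 1 - nx; the second factor is at least 1/2. *)
have : (1 + x) ^+ n * (1 - n%:R * x) <= 1.
  elim: n nx => [|n IH] nx; first by rewrite expr0; lra.
  apply: le_trans (IH _); last by apply: le_trans nx; rewrite ler_wpM2r// ler_nat.
  rewrite exprSr -mulrA ler_wpM2l ?exprn_ge0//; first lra.
  rewrite -natr1; have := ler0n R n; nra.
have : 0 <= (1 + x) ^+ n by rewrite exprn_ge0//; lra.
nra.
Qed.

(* Le Cam's two-point bound, with total variation controlled by the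
   chi-squared divergence. *)
Lemma power_bernoulli_le_cam (p p' : R) (n : nat) (A A' : set (n.-tuple bool)) :
  0 < p -> p < 1 -> 0 <= p' <= 1 -> n%:R * chi2_bernoulli p p' <= 2^-1 ->
  measurable A -> measurable A' -> A `|` A' = setT ->
  ((4^-1)%:E <= power_prob (bernoulli_prob p) n A)%E \/
  ((4^-1)%:E <= power_prob (bernoulli_prob p') n A')%E.
Proof.
move=> p0 p1 p'01 nchi mA mA' AA'.
have [|PA] := leP (4^-1)%:E (power_prob (bernoulli_prob p) n A); first by left.
right; have chi0 : 0 <= chi2_bernoulli p p'.
  by rewrite divr_ge0 ?sqr_ge0// mulr_ge0//; lra.
have := power_bernoulli_sqr_le A p0 p1 p'01.
have := bernoulli_expr_le chi0 nchi.
move: PA; rewrite -[X in (X < _)%E]fineK ?fin_num_measure// lte_fin.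
have : 0 <= fine (power_prob (bernoulli_prob p) n A) by rewrite fine_ge0.
move: (fine _) => a a0 alt cn sqle.
(* The square of this probability is at most 2 * (1/4) < (3/4)^2. *)
have P'A : (power_prob (bernoulli_prob p') n A <= (3 / 4)%:E)%E.
  rewrite -[X in (X <= _)%E]fineK ?fin_num_measure// lee_fin.
  move: sqle; move: (fine _) (_ ^+ n) cn => b c cn; nra.
have : (1 <= power_prob (bernoulli_prob p') n A
         + power_prob (bernoulli_prob p') n A')%E.
  by rewrite -(probability_setT (power_prob (bernoulli_prob p') n)) -AA' measureU2.
move: P'A.
rewrite -[power_prob _ n A]fineK ?fin_num_measure//.
rewrite -[power_prob _ n A']fineK ?fin_num_measure//.
rewrite -EFinD !lee_fin; lra.
Qed.

End power_bernoulli.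

(** * Choice of the two parameters, and the lower bound for estimators *)

Theorem theorem3p2 (R : realType) (phi : R -> \bar R) (tau : R)
    (phi_div : divergence_function phi)
    (phi_dom : exists2 delta : R, 0 < delta &
      `[1 - delta, 1 + delta] `<=` interior (edom phi))
    (phi_superlinear :
      (fun x : R => (phi x * (x^-1)%:E)%E) x @[x --> +oo] --> +oo%E)
    (tau_gt0 : 0 < tau) :
  exists2 pbar : R, 0 < pbar &
    forall (B : R), 1 <= B ->
    forall (eps : R), 0 < eps < B / 4 ->
    forall (n : nat), (0 < n)%N ->
      n%:R <= pbar * B ^+ 2 / (8 * eps ^+ 2) ->
    forall (Rhat : n.-tuple bool -> R), measurable_fun setT Rhat ->
    exists P : probability bool R,
      ((4^-1)%:E <= power_prob P n
         [set w : n.-tuple bool | (eps / 8)%:E <=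
            `| (Rhat w)%:E - robust phi tau P (two_point_payoff B) |])%E.
Proof.
case: (two_point_density_le phi_div tau_gt0 (_ : 0 < 2^-1) phi_superlinear) => //.
move=> r r0 hr; pose p := Num.min r 4^-1.
have p0 : 0 < p by rewrite lt_min r0 invr_gt0 ltr0n.
have p4 : p <= 4^-1 by rewrite ge_min lexx orbT.
have pr : p <= r by rewrite ge_min lexx.
(* This is the denominator of the chi-squared divergence; the bound on [n] then gives
   [n%:R * chi2_bernoulli p p' <= 1/32]. Only [phi] and [tau] enter [p]. *)
exists (p * (1 - p)); first by rewrite mulr_gt0//; lra.
move=> B B1 eps /andP[eps0 epsB] n n0 nle Rhat mRhat.
have B0 : 0 <= B by lra.
have tau0 : 0 <= tau := ltW tau_gt0.
pose h := eps / B; have h0 : 0 < h by rewrite divr_gt0//; lra.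
have h4 : h < 4^-1 by rewrite /h ltr_pdivrMr//; lra.
have hE : h * B = eps by rewrite /h divfK//; apply/eqP; lra.
clearbody h; pose p' := p + h / 2.
have p01 : 0 <= p <= 1 by lra.
have p'01 : 0 <= p' <= 1 by rewrite /p'; lra.
have chi_le : n%:R * chi2_bernoulli p p' <= 2^-1.
  have pp : 0 < p * (1 - p) by rewrite mulr_gt0//; lra.
  move: nle; rewrite -hE ler_pdivlMr; last first.
    by rewrite mulr_gt0// exprn_gt0// mulr_gt0//; lra.
  rewrite (_ : n%:R * (8 * (h * B) ^+ 2) = n%:R * (8 * h ^+ 2) * B ^+ 2); last by ring.
  rewrite ler_pM2r ?exprn_gt0//; last lra.
  move=> nle; rewrite /chi2_bernoulli mulrA ler_pdivrMr// /p'.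
  rewrite (_ : p + h / 2 - p = h / 2); last by ring.
  by nra.
pose X := two_point_payoff B.
pose rho := fine (robust phi tau (bernoulli_prob p) X).
pose rho' := fine (robust phi tau (bernoulli_prob p') X).
have rhoE : robust phi tau (bernoulli_prob p) X = rho%:E.
  by rewrite fineK// robust_two_point_fin_num.
have rho'E : robust phi tau (bernoulli_prob p') X = rho'%:E.
  by rewrite fineK// robust_two_point_fin_num.
have rho_le : rho <= B * 2^-1.
  rewrite -lee_fin -rhoE; apply: robust_two_point_le => // zeta.
  by apply: hr => //; lra.
(* The chord gives rho' - rho >= (1 - lam)(B - rho) >= (h / 2)(B / 2), which is eps / 4. *)
have gap : rho + eps / 4 <= rho'.
  have p'1 : p' < 1 by rewrite /p'; lra.
  have pp' : p <= p' by rewrite /p'; lra.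
  have /= := robust_two_point_chord phi_div B0 tau0 p0 pp' p'1.
  rewrite -/X rhoE rho'E -EFinM -EFinD lee_fin.
  set lam := (_ / _) => chord.
  have lamE : lam * (1 - p) = 1 - p' by rewrite divfK//; apply/eqP; lra.
  have lamh : h / 2 <= 1 - lam.
    rewrite lerBrDr addrC -lerBrDr ler_pdivrMr ?subr_gt0; last lra.
    by rewrite /p'; nra.
  rewrite -hE; nra.
have mE s : measurable [set w | ((eps / 8)%:E <= `|(Rhat w)%:E - s%:E|)%E].
  rewrite -[X in measurable X]setTI; apply: measurable_lee => //.
  apply: measurableT_comp => //; apply: emeasurable_funB => //.
  exact: measurableT_comp.
case: (power_bernoulli_le_cam p0 _ p'01 chi_le (mE rho) (mE rho')) => //.
- lra.
(* No estimate lies within eps / 8 of both values, as they differ by at least twice that; so the two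
   error events cover the sample space. *)
- apply/seteqP; split => // w _ /=; rewrite !lee_fin.
  case: (leP (eps / 8) `|Rhat w - rho|) => [|lt1]; first by left.
  right; rewrite leNgt; apply/negP => lt2.
  by move: lt1 lt2; rewrite !ltr_norml; lra.
- by move=> PA; exists (bernoulli_prob p); rewrite rhoE.
- by move=> PA; exists (bernoulli_prob p'); rewrite rho'E.
Qed.
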